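(* Let $\mathcal{A}=(Q,\Sigma,\delta)$ be a synchronizing deterministic finite automaton with $n=|Q|$ states. Let $u\in\Sigma^*$ be a word of length $l$ and corank $r$ with $1\leqslant r\leqslant n/2-1$. Assume that, for an integer $\lambda$, there exists a word $v$ of length $\lambda$ such that $\operatorname{rk}v\leqslant\operatorname{rk}v'$ for every word $v'$ of length at most $\lambda+2r$. Then there is a word of length at most $l+\lambda+2r$ and corank at least $r+1$.
   Context: A deterministic finite automaton $\mathcal{A}=(Q,\Sigma,\delta)$ has a finite state set $Q$, finite alphabet $\Sigma$ and total transition function $\delta:Q\times\Sigma\to Q$, extended to an action of $\Sigma^*$ on $Q$ written $q\cdot w$; $Q\cdot w=\{q\cdot w:q\in Q\}$. The rank of a word $w$ is $\operatorname{rk}w=|Q\cdot w|$, and its corank is $n-\operatorname{rk}w$ where $n=|Q|$. $\mathcal{A}$ is synchronizing if some word has rank $1$. *)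

(* Defs.v *)
From mathcomp Require Import all_boot.
Set Implicit Arguments. Unset Strict Implicit. Unset Printing Implicit Defensive.

Definition act (Q Sigma : finType) (delta : Q -> Sigma -> Q) (q : Q) (w : seq Sigma) : Q :=
  foldl delta q w.

Definition image_w (Q Sigma : finType) (delta : Q -> Sigma -> Q) (w : seq Sigma) : {set Q} :=
  [set act delta q w | q : Q].

Definition rk (Q Sigma : finType) (delta : Q -> Sigma -> Q) (w : seq Sigma) : nat :=
  #|image_w delta w|.

Definition corank (Q Sigma : finType) (delta : Q -> Sigma -> Q) (w : seq Sigma) : nat :=
  #|Q| - rk delta w.

Definition synchronizing (Q Sigma : finType) (delta : Q -> Sigma -> Q) : Prop :=
  exists w : seq Sigma, rk delta w = 1.

(* Main.v *)
(** Let [J = Q.v] and let [N] be the set of states forming a singleton kernel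
class of [u]; since [u] has corank [r], [N] has at least [n - 2r >= 2] elements.
If no word of the required length has corank above [r], then for [|x| <= 2r] the
set [J.x] has the size of [J] (minimality of [rk v]) and contains [N] (otherwise
[v x u] has smaller rank than [u]). Hence every function [f] that is constant off
[N] and sums to zero over [J] satisfies [sum_(p in J) f (p.x) = 0] for
[|x| <= 2r]. These functions form a space of dimension at least [n - 2r], whereas
the functions summing to zero over [J] form one of dimension [n - 1], so a chain
of subspaces between the two stabilizes early enough to give the identity for
all words [x]. A reset word refutes it. *)

Require Import Defs.
From HB Require Import structures.
From mathcomp Require Import all_boot all_algebra zify.
Set Implicit Arguments. Unset Strict Implicit. Unset Printing Implicit Defensive.
Import GRing.Theory Num.Theory.

(** * Word actions and singleton kernel classes *)

Lemma act_cat (Q Sigma : finType) (delta : Q -> Sigma -> Q) (q : Q)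
  (x y : seq Sigma) : act delta q (x ++ y) = act delta (act delta q x) y.
Proof. exact: foldl_cat. Qed.

Lemma image_w_cat (Q Sigma : finType) (delta : Q -> Sigma -> Q)
  (x y : seq Sigma) :
  image_w delta (x ++ y) = [set act delta q y | q in image_w delta x].
Proof.
by rewrite /image_w -imset_comp; apply: eq_imset => q; rewrite act_cat.
Qed.

Definition singly_hit (Q T : finType) (f : Q -> T) : {set Q} :=
  [set q | [forall p, (f p == f q) ==> (p == q)]].

(** Give each point weight 1, and 1 more if it is alone in its fibre: every nonempty fibre then
    weighs at least 2. *)
Lemma card_singly_hit (Q T : finType) (f : Q -> T) :
  2 * #|[set f q | q : Q]| <= #|Q| + #|singly_hit f|.
Proof.
have -> : #|Q| + #|singly_hit f| = \sum_(q in Q) (1 + (q \in singly_hit f)).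
  by rewrite big_split sum1_card -big_mkcondr sum1_card.
rewrite (partition_big_imset f) mulnC -sum_nat_const.
apply: leq_sum => _ /imsetP[q _ ->]; rewrite (bigD1 q) //=.
have [//|] := boolP (q \in singly_hit f).
rewrite inE negb_forall => /existsP[p]; rewrite negb_imply => /andP[fpq npq].
by rewrite (bigD1 p) /= ?fpq.
Qed.

(** * Stabilizing chains of subspaces *)

Section LinearAlgebra.
Local Open Scope ring_scope.

Lemma foldl_lfun_mem (K : fieldType) (V : vectType K) (Sigma : finType)
    (L : Sigma -> 'End(V)) (S U : {vspace V}) (m : nat) :
    (\dim U < \dim S + m)%N ->
    (forall f w, f \in S -> (size w <= m)%N ->
       foldl (fun g a => L a g) f w \in U) ->
  forall f w, f \in S -> foldl (fun g a => L a g) f w \in U.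
Proof.
move=> dimU SU.
(* [W j] collects the vectors that all words of length at most [j] keep in [U]; it decreases with
   [j]. *)
pose step X := (U :&: \bigcap_a (L a @^-1: X))%VS.
pose W j := iter j step U.
have mem_step X f : (f \in step X) = (f \in U) && [forall a, L a f \in X].
  rewrite memv_cap; congr (_ && _); rewrite memvE.
  apply/subv_bigcapP/forallP => H a; last by move=> _; rewrite -memvE -memv_preim.
  by rewrite memv_preim memvE H.
have memW j f : reflect
    (forall w, (size w <= j)%N -> foldl (fun g a => L a g) f w \in U)
    (f \in W j).
  elim: j f => [|j IH] f.
    by apply: (iffP idP) => [fU [|]|H] //; apply: (H [::]).
  rewrite /W iterS mem_step; apply: (iffP andP) => [[fU /forallP fW] [//|a w]|H].
    by move=> /= sw; move/IH: (fW a); apply.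
  split; first exact: (H [::]).
  by apply/forallP => a; apply/IH => w sw; apply: (H (a :: w)).
have SW j : (j <= m)%N -> (S <= W j)%VS.
  move=> jm; apply/subvP => f fS; apply/memW => w sw.
  by apply: SU => //; apply: leq_trans jm.
have Wdec j : (W j.+1 <= W j)%VS.
  apply/subvP => f /memW H; apply/memW => w sw; apply: H.
  exact: leqW.
have [j jm Wj] : exists2 j, (j < m)%N & W j.+1 = W j.
  have [/existsP[j /eqP Wj]|/existsPn Wj] :=
    boolP [exists j : 'I_m, W j.+1 == W j]; first by exists j.
  (* With [m] strict drops, [W m] would have dimension below that of [S], which it contains. *)
  have dimW j : (j <= m)%N -> (\dim (W j) + j <= \dim U)%N.
    elim: j => [|j IH] jm; first by rewrite addn0.
    apply: leq_trans (IH (ltnW jm)); rewrite addnS -addSn leq_add2r ltnNge.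
    by move: (Wj (Ordinal jm)); rewrite eqEdim Wdec.
  move: dimU; rewrite ltnNge; case/negP.
  by apply: leq_trans (dimW m _); rewrite // leq_add2r dimvS ?SW.
(* Each term is determined by its predecessor, so one repetition freezes the chain. *)
have Wstab k : W (k + j)%N = W j by elim: k => //= k ->.
move=> f w fS.
have /memW : f \in W (size w + j)%N.
  by rewrite Wstab; apply: (subvP (SW j (ltnW jm))).
by apply; apply: leq_addr.
Qed.

(** * Linear conditions on rational-valued functions *)

Definition pullback (T : finType) (h : T -> T) (f : {ffun T -> rat^o}) :
  {ffun T -> rat^o} := [ffun x => f (h x)].

Fact pullback_linear (T : finType) (h : T -> T) : linear (pullback h).
Proof. by move=> a f g; apply/ffunP => x; rewrite !ffunE. Qed.

HB.instance Definition _ (T : finType) (h : T -> T) :=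
  GRing.isLinear.Build rat {ffun T -> rat^o} {ffun T -> rat^o} *:%R (pullback h)
    (pullback_linear h).

Definition sum_on (T : finType) (J : {set T}) (f : {ffun T -> rat^o}) : rat^o :=
  \sum_(p in J) f p.

Fact sum_on_linear (T : finType) (J : {set T}) : linear (sum_on J).
Proof.
move=> a f g; rewrite /sum_on scaler_sumr -big_split /=.
by apply: eq_bigr => p _; rewrite !ffunE.
Qed.

HB.instance Definition _ (T : finType) (J : {set T}) :=
  GRing.isLinear.Build rat {ffun T -> rat^o} rat^o *:%R (sum_on J)
    (sum_on_linear J).

(* The coordinate at [m0], which the differences leave free, is used for the sum
   over [J]: the kernel is cut out by only [#|M|] equations. *)
Definition const_sum (T : finType) (J M : {set T}) (m0 : T)
    (f : {ffun T -> rat^o}) : {ffun {m | m \in M} -> rat^o} :=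
  [ffun m => if val m == m0 then sum_on J f else f (val m) - f m0].

Fact const_sum_linear (T : finType) (J M : {set T}) (m0 : T) :
  linear (const_sum J M m0).
Proof.
move=> a f g; apply/ffunP => m; rewrite !ffunE.
case: ifP => _; first by rewrite linearP.
by rewrite scalerBr opprD addrACA.
Qed.

HB.instance Definition _ (T : finType) (J M : {set T}) (m0 : T) :=
  GRing.isLinear.Build rat {ffun T -> rat^o} {ffun {m | m \in M} -> rat^o} *:%R
    (const_sum J M m0) (const_sum_linear J M m0).

Lemma dim_ffun_rat (T : finType) : \dim {: {ffun T -> rat^o}} = #|T|.
Proof. by rewrite dimvf; apply: muln1. Qed.

Lemma dim_ker_sum_on (T : finType) (J : {set T}) :
  J != set0 -> (\dim (lker (linfun (sum_on J))) < #|T|)%N.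
Proof.
move=> J0; rewrite -dim_ffun_rat ltnNge; apply/negP => le_dim.
have /eqP kerJ : lker (linfun (sum_on J)) == fullv by rewrite eqEdim subvf.
have : [ffun=> 1] \in lker (linfun (sum_on J)) by rewrite kerJ memvf.
rewrite memv_ker lfunE /= /sum_on.
under eq_bigr do rewrite ffunE.
by rewrite sumr_const pnatr_eq0 cards_eq0 (negPf J0).
Qed.

Lemma dim_ker_const_sum (T : finType) (J M : {set T}) (m0 : T) :
  (#|T| <= \dim (lker (linfun (const_sum J M m0))) + #|M|)%N.
Proof.
rewrite -dim_ffun_rat -(limg_ker_dim (linfun (const_sum J M m0)) fullv) capfv.
rewrite leq_add2l.
apply: leq_trans (dimvS (subvf _)) _.
by rewrite dim_ffun_rat card_sig.
Qed.

Lemma mem_ker_const_sum (T : finType) (J M : {set T}) (m0 : T)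
    (f : {ffun T -> rat^o}) : m0 \in M ->
  reflect ((forall m, m \in M -> f m = f m0) /\ sum_on J f = 0)
    (f \in lker (linfun (const_sum J M m0))).
Proof.
move=> m0M; rewrite memv_ker lfunE; apply: (iffP eqP) => [/ffunP f0|[fM f0]].
  split=> [m mM|]; last by move: (f0 (Sub m0 m0M)); rewrite !ffunE /= eqxx.
  have := f0 (Sub m mM); rewrite !ffunE /=.
  by case: eqP => [-> //|_] /eqP; rewrite subr_eq0 => /eqP.
apply/ffunP => -[m mM]; rewrite !ffunE /= f0 fM // subrr.
by case: ifP.
Qed.

(** Outside [N] only the number of summands matters, and it is the same for [A] and [B]. *)
Lemma eq_sum_const_off (T : finType) (N A B : {set T}) (f : T -> rat) (c : rat) :
    {in ~: N, forall p, f p = c} -> N \subset A -> N \subset B -> #|A| = #|B| ->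
  \sum_(p in A) f p = \sum_(p in B) f p.
Proof.
move=> fc sNA sNB cAB.
have sumE (C : {set T}) : N \subset C ->
    \sum_(p in C) f p = \sum_(p in N) f p + c *+ (#|C| - #|N|).
  move=> sNC; rewrite (big_setID N) /= (setIidPr sNC); congr (_ + _).
  rewrite -{2}(setIidPr sNC) -cardsD -sumr_const; apply: eq_bigr => p.
  by rewrite inE => /andP[pN _]; apply: fc; rewrite inE.
by rewrite (sumE A) // (sumE B) // cAB.
Qed.

Lemma synchronizing_escape (Q Sigma : finType) (delta : Q -> Sigma -> Q)
    (J N : {set Q}) (m : nat) :
    synchronizing delta -> (2 <= #|N|)%N -> N != setT -> (#|Q| <= #|N| + m)%N ->
    (forall x, (size x <= m)%N ->
       #|[set act delta p x | p in J]| = #|J| /\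
       N \subset [set act delta p x | p in J]) ->
  False.
Proof.
move=> [w /eqP/cards1P[t wt]] N2 NT leQ HJ.
have JN : N \subset J by have [_] := HJ [::] isT; rewrite imset_id.
have J0 : J != set0.
  by rewrite -card_gt0; apply: leq_trans (subset_leq_card JN); apply: ltnW.
have [m0 m0N] : exists m0, m0 \in ~: N.
  by apply/set0Pn; apply: contraNneq NT => N0; rewrite -[N]setCK N0 setC0.
pose L a := linfun (pullback (delta^~ a)).
(* Pullback is contravariant: the letter folded last acts first on the states, hence [rev]. *)
have foldlL (f : {ffun Q -> rat^o}) x :
    foldl (fun g a => L a g) f x = [ffun q => f (act delta q (rev x))].
  elim: x f => [|a x IH] f /=; first by apply/ffunP => q; rewrite ffunE.
  rewrite IH lfunE; apply/ffunP => q; rewrite !ffunE.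
  by rewrite rev_cons -cats1 act_cat.
have mem_all := @foldl_lfun_mem _ _ _ L (lker (linfun (const_sum J (~: N) m0)))
  (lker (linfun (sum_on J))) m.
have sum0 (f : {ffun Q -> rat^o}) x :
    (forall p, p \in ~: N -> f p = f m0) -> sum_on J f = 0 ->
  \sum_(p in J) f (act delta p x) = 0.
  move=> fN f0.
  have : foldl (fun g a => L a g) f (rev x) \in lker (linfun (sum_on J)).
    apply: mem_all; last exact/mem_ker_const_sum.
      have := dim_ker_sum_on J0; have := dim_ker_const_sum J (~: N) m0.
      have := cardsC N; lia.
    move=> g y /(mem_ker_const_sum J g m0N)[gN g0] sy.
    rewrite foldlL memv_ker lfunE /= /sum_on.
    under eq_bigr do rewrite ffunE.
    have [|cJ sN] := HJ (rev y); first by rewrite size_rev.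
    (* Equal cardinality makes [rev y] act injectively on [J], so the sum can be reindexed over the
       image of [J]. *)
    rewrite -(big_imset g) /=; last exact/imset_injP/eqP/cJ.
    by rewrite (@eq_sum_const_off _ N _ J g (g m0)) ?cJ ?sN //; apply/eqP.
  rewrite foldlL memv_ker lfunE /= /sum_on revK => /eqP fx0.
  by rewrite -[RHS]fx0; apply: eq_bigr => p _; rewrite ffunE.
have [q qN qt] : exists2 q, q \in N & q != t.
  have /set0Pn[q] : N :\ t != set0.
    by rewrite -card_gt0; have := cardsD1 t N; case: (t \in N); lia.
  by rewrite !inE => /andP[qt qN]; exists q.
(* The value at [q] makes the sum over [J] vanish; the reset word sends every state to [t], away
   from [q], so the sum becomes [#|J|], which is nonzero. *)
pose f : {ffun Q -> rat^o} := [ffun p => if p == q then 1 - #|J|%:R else 1].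
have fN p : p \in ~: N -> f p = 1.
  by rewrite inE ffunE; case: eqP => // ->; rewrite qN.
have f0 : sum_on J f = 0.
  rewrite /sum_on (bigD1 q) ?(subsetP JN) //= ffunE eqxx.
  rewrite (eq_bigr (fun=> 1)) => [|p /andP[_ /negPf pq]]; last by rewrite ffunE pq.
  rewrite sumr_const; have -> : #|[pred p in J | p != q]| = (#|J| - 1)%N.
    rewrite (cardsD1 q J) (subsetP JN) // addnC addnK.
    by apply: eq_card => p; rewrite !inE andbC.
  by rewrite natrB ?card_gt0 // addrC subrKA subrr.
have := sum0 f w _ f0; rewrite (eq_bigr (fun=> 1)) => [|p _]; last first.
  have : act delta p w \in image_w delta w by apply: imset_f.
  by rewrite wt inE ffunE => /eqP->; rewrite eq_sym (negPf qt).
rewrite sumr_const => sumw.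
have /eqP : #|J|%:R = 0 :> rat by apply: sumw => p pN; rewrite !fN.
by rewrite pnatr_eq0 cards_eq0 (negPf J0).
Qed.

End LinearAlgebra.

Theorem theorem2 (Q Sigma : finType) (delta : Q -> Sigma -> Q)
  (u : seq Sigma) (l r lambda : nat) :
  synchronizing delta ->
  size u = l ->
  corank delta u = r ->
  1 <= r -> 2 * (r + 1) <= #|Q| ->
  (exists v : seq Sigma, size v = lambda /\
     forall v' : seq Sigma, size v' <= lambda + 2 * r -> rk delta v <= rk delta v') ->
  exists w : seq Sigma, size w <= l + lambda + 2 * r /\ r + 1 <= corank delta w.
Proof.
move=> sync su cu r1 rQ [v [sv vmin]].
set b := l + lambda + 2 * r.
(* Words of length at most [b] form a finite search space, so the case split is decidable. *)
have [/existsP[k /existsP[w rw]]|/existsPn none] := boolP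
    [exists k : 'I_b.+1, [exists w : k.-tuple Sigma, r + 1 <= corank delta w]].
  by exists w; split=> //; rewrite size_tuple -ltnS.
have rk_ge w : size w <= b -> rk delta u <= rk delta w.
  move=> sw; have /existsPn/(_ (in_tuple w)) := none (Ordinal (sw : size w < b.+1)).
  rewrite /= -ltnNge -cu /corank => rw.
  by have := max_card (mem (image_w delta u)); rewrite -/(rk _ u); lia.
have rku : rk delta u + r = #|Q|.
  by rewrite -cu subnKC //; apply: max_card.
pose N := singly_hit (act delta ^~ u).
have cN := card_singly_hit (act delta ^~ u); rewrite -/N -/(rk delta u) in cN.
have NT : N != setT.
  apply: contraTneq r1 => NT; suff : rk delta u = #|Q| by lia.
  rewrite /rk /image_w card_imset // => p q epq.
  have : q \in N by rewrite NT.
  by rewrite inE => /forallP/(_ p); rewrite epq eqxx => /eqP.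
(* Both bounds on [#|N|] come from [cN] and [rku], which give [#|N| >= #|Q| - 2 * r]. *)
case: (@synchronizing_escape _ _ delta (image_w delta v) N (2 * r)) => //; [lia|lia|].
move=> x sx; rewrite -image_w_cat; split.
  apply/eqP; rewrite eqn_leq image_w_cat leq_imset_card -image_w_cat.
  by apply: vmin; rewrite size_cat sv leq_add2l.
(* The image of a word ending in [u] lies in that of [u], and [rk_ge] forbids a smaller one. A state
   of [N] is the sole preimage of its image under [u], so [v ++ x] must reach it. *)
have vxu : image_w delta ((v ++ x) ++ u) = image_w delta u.
  apply/eqP; rewrite eqEcard; apply/andP; split.
    by rewrite image_w_cat; apply/subsetP => _ /imsetP[q _ ->]; apply: imset_f.
  by apply: rk_ge; rewrite !size_cat; lia.
apply/subsetP => q; rewrite inE => /forallP qN.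
have : act delta q u \in image_w delta ((v ++ x) ++ u) by rewrite vxu imset_f.
rewrite image_w_cat => /imsetP[p pvx eqp].
by have := qN p; rewrite -eqp eqxx => /eqP <-.
Qed.
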